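(* Let $(\mathcal{P},\Omega)$ be a poset equipped with an $\mathbb{R}$-flow and let $\mathcal{F}$ be a family of intervals in $\mathcal{P}$ that contains the empty interval, is closed under intersections (for all $I,J\in\mathcal{F}$, $I\cap J$ is an interval belonging to $\mathcal{F}$), and is closed under the action of $\Omega$ (for all $I\in\mathcal{F}$ and $t\in\mathbb{R}$, $\Omega_t(I)\in\mathcal{F}$). Let $M,N:\mathcal{P}\to\mathbf{Vect}_{\mathbb{K}}$ be two interval-decomposable $\mathcal{P}$-modules whose barcodes satisfy $B(M),B(N)\subset\mathcal{F}$. Then $$d_{\mathrm{H}}(M,N)\leq 2\cdot d_{\mathrm{I}}(M,N).$$
   Context: $\mathbb{K}$ is a fixed field and $\mathbf{Vect}_{\mathbb{K}}$ is the category of $\mathbb{K}$-vector spaces. A poset $\mathcal{P}$ is regarded as a category with a unique morphism $p\to q$ iff $p\le q$. Intervals: $I\subset\mathcal{P}$ is poset-convex if $p,q\in I$, $r\in\mathcal{P}$, $p\le r\le q$ imply $r\in I$. It is poset-connected if for all $p,q\in I$ there are $r_1,\dots,r_{2n}\in I$ with $p\le r_1\ge r_2\le\cdots\le r_{2n-1}\ge r_{2n}\le q$. An interval is a poset-convex and poset-connected subset; the empty set is an interval (the empty interval). $\mathcal{P}$-modules: a $\mathcal{P}$-module is a functor $M:\mathcal{P}\to\mathbf{Vect}_{\mathbb{K}}$, with spaces $M_p$ and structure maps $\varphi_M(p,q):M_p\to M_q$ for $p\le q$; morphisms are natural transformations. For an interval $I$, the interval module $C(I)$ has $C(I)_p=\mathbb{K}$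 if $p\in I$ and $0$ otherwise, with $\varphi_{C(I)}(p,q)=\mathrm{Id}_{\mathbb{K}}$ if $p,q\in I$ and $0$ otherwise; $C(\varnothing)=\mathbf{0}$. $M$ is interval-decomposable if $M\cong\bigoplus_{I\in B(M)}C(I)$ for a multiset $B(M)$ (an indexed family, possibly infinite) of nonempty intervals, called the barcode of $M$; it is uniquely determined by $M$. $\mathbb{R}$-flow: a family $\Omega=(\Omega_t:\mathcal{P}\to\mathcal{P})_{t\in\mathbb{R}}$ of order-preserving maps with $\Omega_t(p)\le\Omega_s(p)$ for all $t\le s$ and $p\in\mathcal{P}$, $\Omega_{t+s}=\Omega_t\circ\Omega_s$, and $\Omega_0=\mathrm{id}_{\mathcal{P}}$. Shifts and interleavings: for $t\in\mathbb{R}$, the module $M(t)$ has $M(t)_p=M_{\Omega_t(p)}$ and $\varphi_{M(t)}(p,q)=\varphi_M(\Omega_t(p),\Omega_t(q))$; for a morphism $f$, $f(t)_p=f_{\Omega_t(p)}$. For $\delta\ge0$, the transition morphism $\varphi_M^{\delta}:M\to M(\delta)$ is given at $p$ by $\varphi_M(p,\Omega_\delta(p))$. For $\varepsilon\ge 0$, $M,N$ are $\varepsilon$-interleaved if there are morphisms $f:M\to N(\varepsilon)$ and $g:N\to M(\varepsilon)$ with $g(\varepsilon)\circ f=\varphi_M^{2\varepsilon}$ and $f(\varepsilon)\circ g=\varphi_N^{2\varepsilon}$. The interleaving distance is $d_{\mathrm{I}}(M,N)=\inf\{\varepsilon\ge0\mid M,N\text{ are }\varepsilon\text{-interleaved}\}\in[0,\infty]$,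 with $\inf\varnothing=\infty$. Hausdorff distance: for interval-decomposable $M,N$ and $\varepsilon\ge0$, an $\varepsilon$-correspondence between $M$ and $N$ is a sub-multiset $\sigma\subset B(M)\times B(N)$ (elements considered with multiplicity, i.e. a relation between the index sets of the two barcodes) such that (i) for each $(I,J)\in\sigma$, $C(I)$ and $C(J)$ are $\varepsilon$-interleaved; (ii) each $I\in B(M)$ not belonging to any pair in $\sigma$ has $C(I)$ $\varepsilon$-interleaved with the zero module; (iii) each $J\in B(N)$ not belonging to any pair in $\sigma$ has $C(J)$ $\varepsilon$-interleaved with the zero module. Then $d_{\mathrm{H}}(M,N)=\inf\{\varepsilon\ge0\mid\text{there exists an }\varepsilon\text{-correspondence between }M\text{ and }N\}$ (with $\inf\varnothing=\infty$). *)

(* Defs.v *)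
From HB Require Import structures.
From mathcomp Require Import all_boot all_order all_algebra.
From mathcomp Require Import all_classical all_reals interval_inference ereal.

Set Implicit Arguments.
Unset Strict Implicit.
Unset Printing Implicit Defensive.

Import Order.TTheory GRing.Theory Num.Theory.
Local Open Scope classical_set_scope.
Local Open Scope ring_scope.

Section Posets.
Context {d : Order.disp_t} {P : porderType d}.
Implicit Types (I : set P) (p q r : P).

Definition poset_convex I : Prop :=
  forall p q r, I p -> I q -> (p <= r)%O -> (r <= q)%O -> I r.

(* The zigzag p <= r 1 >= r 2 <= r 3 >= ... >= r (2n) <= q, with r 0 := p. *)
Definition poset_connected I : Prop :=
  forall p q, I p -> I q -> exists (n : nat) (r : nat -> P),
    [/\ r 0 = p,
        (forall k, (k <= n.*2)%N -> I (r k)),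
        (forall k, (k < n)%N ->
           (r k.*2 <= r k.*2.+1)%O /\ (r k.*2.+2 <= r k.*2.+1)%O)
      & (r n.*2 <= q)%O].

Definition is_poset_interval I : Prop := poset_convex I /\ poset_connected I.

Record poset_interval := PosetInterval {
  poset_interval_set :> set P;
  poset_interval_prop : is_poset_interval poset_interval_set }.

Record flow (R : realType) := Flow {
  flow_map :> R -> P -> P;
  flow_homo : forall t p q, (p <= q)%O -> (flow_map t p <= flow_map t q)%O;
  flow_le : forall t s p, t <= s -> (flow_map t p <= flow_map s p)%O;
  flowD : forall t s p, flow_map (t + s) p = flow_map t (flow_map s p);
  flow0 : forall p, flow_map 0 p = p }.

End Posets.
Arguments poset_interval {d} P.
Arguments flow {d} P R.

(* Direct sum of a possibly infinite family of vector spaces: the finitely    *)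
(* supported elements of the product.                                         *)
Section DirectSum.
Context {K : fieldType} {A : Type} (V : A -> lmodType K).

Record dsum := DSum {
  dsum_val :> forall a, V a;
  dsum_finite : finite_set [set a | dsum_val a != 0] }.

Lemma dsum_ext (x y : dsum) : (forall a, x a = y a) -> x = y.
Proof.
case: x => x hx; case: y => y hy /= xy.
have {}xy : x = y by apply: functional_extensionality_dep.
by subst y; congr DSum; exact: Prop_irrelevance.
Qed.

HB.instance Definition _ := gen_eqMixin dsum.
HB.instance Definition _ := gen_choiceMixin dsum.

Lemma dsum0_finite : finite_set [set a | (0 : V a) != 0].
Proof.
by rewrite (_ : mkset _ = set0) // -subset0 => a /=; rewrite eqxx.
Qed.
Definition dsum0 := DSum dsum0_finite.

Lemma dsumN_finite (x : dsum) : finite_set [set a | - x a != 0].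
Proof.
by apply: sub_finite_set (dsum_finite x) => a /=; rewrite oppr_eq0.
Qed.
Definition dsumN x := DSum (dsumN_finite x).

Lemma dsumD_finite (x y : dsum) : finite_set [set a | x a + y a != 0].
Proof.
have fin : finite_set ([set a | x a != 0] `|` [set a | y a != 0]).
  by rewrite finite_setU; split; exact: dsum_finite.
apply: sub_finite_set fin => a /= nz.
have [xa0|?] := eqVneq (x a) 0; last by left.
by right; move: nz; rewrite xa0 add0r.
Qed.
Definition dsumD x y := DSum (dsumD_finite x y).

Lemma dsumZ_finite (k : K) (x : dsum) : finite_set [set a | k *: x a != 0].
Proof.
apply: sub_finite_set (dsum_finite x) => a /= nz.
by apply: contra_neq nz => ->; rewrite scaler0.
Qed.
Definition dsumZ k x := DSum (dsumZ_finite k x).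

Lemma dsumA : associative dsumD.
Proof. by move=> x y z; apply: dsum_ext => a /=; rewrite addrA. Qed.
Lemma dsumC : commutative dsumD.
Proof. by move=> x y; apply: dsum_ext => a /=; rewrite addrC. Qed.
Lemma dsum_add0 : left_id dsum0 dsumD.
Proof. by move=> x; apply: dsum_ext => a /=; rewrite add0r. Qed.
Lemma dsum_addN : left_inverse dsum0 dsumN dsumD.
Proof. by move=> x; apply: dsum_ext => a /=; rewrite addNr. Qed.
HB.instance Definition _ :=
  GRing.isZmodule.Build dsum dsumA dsumC dsum_add0 dsum_addN.

Lemma dsum_scaleA k l (x : dsum) : dsumZ k (dsumZ l x) = dsumZ (k * l) x.
Proof. by apply: dsum_ext => a /=; rewrite scalerA. Qed.
Lemma dsum_scale1 : left_id 1 dsumZ.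
Proof. by move=> x; apply: dsum_ext => a /=; rewrite scale1r. Qed.
Lemma dsum_scaleDr : right_distributive dsumZ +%R.
Proof. by move=> k x y; apply: dsum_ext => a /=; rewrite scalerDr. Qed.
Lemma dsum_scaleDl (x : dsum) : {morph dsumZ^~ x : k l / k + l >-> k + l}.
Proof. by move=> k l; apply: dsum_ext => a /=; rewrite scalerDl. Qed.
HB.instance Definition _ := GRing.Zmodule_isLmodule.Build K dsum
  dsum_scaleA dsum_scale1 dsum_scaleDr dsum_scaleDl.

End DirectSum.

Section DirectSumMap.
Context {K : fieldType} {A : Type} {V W : A -> lmodType K}.
Variable f : forall a, {linear V a -> W a}.

Lemma dsum_map_finite (x : dsum V) : finite_set [set a | f a (x a) != 0].
Proof.
apply: sub_finite_set (dsum_finite x) => a /= nz.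
by apply: contra_neq nz => ->; rewrite linear0.
Qed.
Definition dsum_map (x : dsum V) : dsum W := DSum (dsum_map_finite x).

Lemma dsum_map_linear : linear dsum_map.
Proof. by move=> k x y; apply: dsum_ext => a; exact: linearP. Qed.
HB.instance Definition _ :=
  GRing.isLinear.Build K (dsum V) (dsum W) *:%R dsum_map dsum_map_linear.

End DirectSumMap.

Section PModules.
Context {K : fieldType} {d : Order.disp_t} {P : porderType d}.

Record pmodule := PModule {
  pm_space :> P -> lmodType K;
  pm_map : forall p q, (p <= q)%O -> {linear pm_space p -> pm_space q};
  pm_map_id : forall p (pp : (p <= p)%O) x, pm_map pp x = x;
  pm_map_comp : forall p q r (pq : (p <= q)%O) (qr : (q <= r)%O)
    (pr : (p <= r)%O) x, pm_map qr (pm_map pq x) = pm_map pr x }.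

Record pmorphism (M N : pmodule) := PMorphism {
  pmor :> forall p, {linear M p -> N p};
  pmor_natural : forall p q (pq : (p <= q)%O) x,
    pmor q (pm_map M pq x) = pm_map N pq (pmor p x) }.

Lemma pmor_comp_natural (L M N : pmodule) (g : pmorphism M N)
    (f : pmorphism L M) p q (pq : (p <= q)%O) x :
  (g q \o f q) (pm_map L pq x) = pm_map N pq ((g p \o f p) x).
Proof. by rewrite /= !pmor_natural. Qed.
Definition pmor_comp (L M N : pmodule) (g : pmorphism M N)
    (f : pmorphism L M) : pmorphism L N :=
  @PMorphism L N (fun p => g p \o f p) (pmor_comp_natural g f).

Definition pmor_eq (M N : pmodule) (f g : pmorphism M N) : Prop :=
  forall p x, f p x = g p x.

Definition pmod_iso (M N : pmodule) : Prop :=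
  exists (f : pmorphism M N) (g : pmorphism N M),
    (forall p, cancel (f p) (g p)) /\ (forall p, cancel (g p) (f p)).

Definition zero_pmodule : pmodule.
Proof.
refine (@PModule (fun=> 'rV[K]_0) (fun _ _ _ => \0) _ _).
- by move=> p pp x; apply/rowP; case.
- by [].
Defined.

Definition interval_space (b : bool) : lmodType K :=
  if b then (K^o : lmodType K) else ('rV[K]_0 : lmodType K).

Definition interval_map (b c : bool) :
    {linear interval_space b -> interval_space c} :=
  match b, c return {linear interval_space b -> interval_space c} with
  | true, true => idfun
  | _, _ => \0
  end.

Lemma interval_map_id (b : bool) x : interval_map b b x = x.
Proof. by case: b x => //= x; apply/rowP; case. Qed.

Lemma interval_map_comp (b1 b2 b3 : bool) x : (b1 -> b3 -> b2) ->
  interval_map b2 b3 (interval_map b1 b2 x) = interval_map b1 b3 x.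
Proof. by case: b1 b2 b3 x => [] [] [] x // /(_ isT isT). Qed.

Section IntervalModule.
Variable I : poset_interval P.

Lemma interval_pmodule_comp p q r (pq : (p <= q)%O) (qr : (q <= r)%O)
    (pr : (p <= r)%O) x :
  interval_map (q \in (I : set P)) (r \in (I : set P))
    (interval_map (p \in (I : set P)) (q \in (I : set P)) x) =
  interval_map (p \in (I : set P)) (r \in (I : set P)) x.
Proof.
apply: interval_map_comp => /set_mem Ip /set_mem Ir; apply/mem_set.
have [cvx _] := poset_interval_prop I.
exact: cvx Ip Ir pq qr.
Qed.

Definition interval_pmodule : pmodule :=
  @PModule (fun p => interval_space (p \in (I : set P)))
    (fun p q _ => interval_map (p \in (I : set P)) (q \in (I : set P)))
    (fun p _ => @interval_map_id (p \in (I : set P)))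
    interval_pmodule_comp.
End IntervalModule.

Section DirectSumModule.
Context {A : Type} (M : A -> pmodule).

Lemma dsum_pmodule_id p (pp : (p <= p)%O) (x : dsum (M ^~ p)) :
  dsum_map (fun a => pm_map (M a) pp) x = x.
Proof. by apply: dsum_ext => a; exact: pm_map_id. Qed.

Lemma dsum_pmodule_comp p q r (pq : (p <= q)%O) (qr : (q <= r)%O)
    (pr : (p <= r)%O) (x : dsum (M ^~ p)) :
  dsum_map (fun a => pm_map (M a) qr) (dsum_map (fun a => pm_map (M a) pq) x) =
  dsum_map (fun a => pm_map (M a) pr) x.
Proof. by apply: dsum_ext => a; exact: pm_map_comp. Qed.

Definition dsum_pmodule : pmodule :=
  @PModule (fun p => dsum (M ^~ p))
    (fun p q pq => dsum_map (fun a => pm_map (M a) pq))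
    dsum_pmodule_id dsum_pmodule_comp.
End DirectSumModule.

(* The multiset B(M) is an indexed family B of nonempty intervals. *)
Definition is_barcode {A : Type} (M : pmodule) (B : A -> poset_interval P) : Prop :=
  (forall a, B a !=set0) /\
  pmod_iso M (dsum_pmodule (fun a => interval_pmodule (B a))).

End PModules.
Arguments pmodule K {d} P.
Arguments zero_pmodule {K d P}.
Arguments interval_pmodule K {d P} I.

Section Interleavings.
Context {R : realType} {K : fieldType} {d : Order.disp_t} {P : porderType d}.
Variable Om : flow P R.
Implicit Types (M N : pmodule K P) (t : R) (e : {nonneg R}).

Definition pm_shift M t : pmodule K P :=
  @PModule K d P (fun p => M (Om t p))
    (fun p q pq => pm_map M (flow_homo Om t pq))
    (fun p pp => pm_map_id (flow_homo Om t pp))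
    (fun p q r pq qr pr => pm_map_comp (flow_homo Om t pq)
       (flow_homo Om t qr) (flow_homo Om t pr)).

Definition pm_shift_mor M N (f : pmorphism M N) t :
    pmorphism (pm_shift M t) (pm_shift N t) :=
  @PMorphism K d P (pm_shift M t) (pm_shift N t) (fun p => f (Om t p))
    (fun p q pq => pmor_natural f (flow_homo Om t pq)).

Lemma flow_ge e p : (p <= Om e%:num p)%O.
Proof. by rewrite -[X in (X <= _)%O](flow0 Om) flow_le. Qed.

Lemma transition_natural M e p q (pq : (p <= q)%O) x :
  pm_map M (flow_ge e q) (pm_map M pq x) =
  pm_map (pm_shift M e%:num) pq (pm_map M (flow_ge e p) x).
Proof.
have pq' := le_trans pq (flow_ge e q).
by rewrite (pm_map_comp _ _ pq') (pm_map_comp _ _ pq').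
Qed.
Definition pm_transition M e : pmorphism M (pm_shift M e%:num) :=
  @PMorphism K d P M (pm_shift M e%:num)
    (fun p => pm_map M (flow_ge e p)) (@transition_natural M e).

(* M(s)(t)_p = M_(Om s (Om t p)) and M(s + t)_p = M_(Om (s + t) p) sit at     *)
(* provably equal points of P; the structure map between them is the          *)
(* identification M(s)(t) = M(s + t).                                         *)
Lemma flowD_le s t p : (Om s (Om t p) <= Om (s + t) p)%O.
Proof. by rewrite flowD. Qed.

Lemma shiftD_natural M s t p q (pq : (p <= q)%O) x :
  pm_map M (flowD_le s t q) (pm_map (pm_shift (pm_shift M s) t) pq x) =
  pm_map (pm_shift M (s + t)) pq (pm_map M (flowD_le s t p) x).
Proof.
have pq' := le_trans (flowD_le s t p) (flow_homo Om (s + t) pq).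
by rewrite (pm_map_comp _ _ pq') (pm_map_comp _ _ pq').
Qed.
Definition shiftD M s t :
    pmorphism (pm_shift (pm_shift M s) t) (pm_shift M (s + t)) :=
  @PMorphism K d P (pm_shift (pm_shift M s) t) (pm_shift M (s + t))
    (fun p => pm_map M (flowD_le s t p)) (@shiftD_natural M s t).

Definition pm_interleaved e M N : Prop :=
  exists (f : pmorphism M (pm_shift N e%:num))
         (g : pmorphism N (pm_shift M e%:num)),
    pmor_eq (pmor_comp (shiftD M e%:num e%:num)
               (pmor_comp (pm_shift_mor g e%:num) f))
            (pm_transition M (e%:num + e%:num)%:nng) /\
    pmor_eq (pmor_comp (shiftD N e%:num e%:num)
               (pmor_comp (pm_shift_mor f e%:num) g))
            (pm_transition N (e%:num + e%:num)%:nng).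

Definition interleaving_dist M N : \bar R :=
  ereal_inf [set (e%:num)%:E |
    e in [set e : {nonneg R} | pm_interleaved e M N]].

Definition is_correspondence e {A A' : Type} (B : A -> poset_interval P)
    (B' : A' -> poset_interval P) (sigma : A -> A' -> Prop) : Prop :=
  [/\ (forall a a', sigma a a' ->
         pm_interleaved e (interval_pmodule K (B a))
           (interval_pmodule K (B' a'))),
      (forall a, ~ (exists a', sigma a a') ->
         pm_interleaved e (interval_pmodule K (B a)) zero_pmodule)
    & (forall a', ~ (exists a, sigma a a') ->
         pm_interleaved e (interval_pmodule K (B' a')) zero_pmodule)].

(* d_H(M, N), as a function of the barcodes B of M and B' of N. *)
Definition hausdorff_dist {A A' : Type} (B : A -> poset_interval P)
    (B' : A' -> poset_interval P) : \bar R :=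
  ereal_inf [set (e%:num)%:E | e in [set e : {nonneg R} |
    exists sigma : A -> A' -> Prop, is_correspondence e B B' sigma]].

End Interleavings.
Arguments hausdorff_dist {R} K {d P} Om {A A'} B B'.
Arguments is_correspondence {R} K {d P} Om e {A A'} B B' sigma.

(* Main.v *)
Require Import Defs.
From HB Require Import structures.
From mathcomp Require Import all_boot all_order all_algebra.
From mathcomp Require Import all_classical all_reals interval_inference ereal.

Set Implicit Arguments.
Unset Strict Implicit.
Unset Printing Implicit Defensive.

Import Order.TTheory GRing.Theory Num.Theory.
Local Open Scope classical_set_scope.
Local Open Scope ring_scope.

(** Fix an e-interleaving [f], [g] of [M] and [N]; it suffices to produce a
2e-correspondence between the barcodes. The relation used is that of being
e-interleaved, so the point is that a bar [I] of [M] that is e-interleaved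
with no bar of [N] is 2e-interleaved with zero, that is, no point [p]
satisfies both [I p] and [I (Om (4e) p)].

Suppose that such a [p] exists. The composite of [f] and [g], restricted to
the summand [C(I)] and projected back to it, is the transition morphism by 2e,
which is nonzero at [p] by convexity of [I]. This composite is at [p] a finite
sum over the bars of [N], so some bar [J] of [N] gives components of [f] and
[g] between [C(I)] and [C(J)] whose composite is nonzero at [p]
([half_interleaving_match]).

These components, with one of them rescaled, e-interleave [C(I)] and [C(J)]
([interval_interleaved_of_comp_neq0]). Indeed both composites are morphisms
from an interval module to its shift by 2e. The closure properties of the
family of intervals make the common support of such a module and its shift
connected, so that these morphisms are determined by their value at one point
of it ([pmor_coef_unique]). The composite on [C(I)] is nonzero at [p] and is
rescaled to the transition; as the transition is also nonzero at [Om (2e) p],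
the interval [J] contains [Om e p] and [Om (3e) p], and at [Om e p] the
composite on [C(J)] has the same coefficient as the one on [C(I)] at [p]. *)

(** * Connected sets and flows *)

(** Walk along the zigzag: consecutive points are comparable. *)
Lemma poset_connected_const (d : Order.disp_t) (P : porderType d) (T : Type)
    (I : set P) (phi : P -> T) :
  poset_connected I ->
  (forall p q, I p -> I q -> (p <= q)%O -> phi p = phi q) ->
  forall p q, I p -> I q -> phi p = phi q.
Proof.
move=> Iconn phiE p q Ip Iq.
have [n [r [r0 rI rle rq]]] := Iconn p q Ip Iq.
rewrite -(phiE (r n.*2) q) //; last exact: rI.
suff {rq} H k : (k <= n)%N -> phi p = phi (r k.*2) by exact: H.
elim: k => [_|k IHk kn]; first by rewrite r0.
have [le1 le2] := rle k kn.
have I1 : I (r k.*2.+1).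
  by apply: rI; rewrite -leq_double doubleS in kn; exact: ltnW.
have I0 : I (r k.*2) by apply: rI; rewrite leq_double ltnW.
have I2 : I (r k.+1.*2) by apply: rI; rewrite leq_double.
by rewrite (IHk (ltnW kn)) (phiE _ _ I0 I1 le1) (phiE _ _ I2 I1 le2).
Qed.

(** A flow map is bijective, so a family closed under images by the flow is
also closed under preimages. *)
Lemma flow_preimage (R : realType) (d : Order.disp_t) (P : porderType d)
    (Om : flow P R) (t : R) (I : set P) : Om t @^-1` I = Om (- t) @` I.
Proof.
apply/seteqP; split=> [p Ip|_ [p Ip <-]] /=.
  by exists (Om t p) => //; rewrite -flowD addNr flow0.
by rewrite -flowD addrN flow0.
Qed.

(** * Modules and interleavings *)

Section Modules.
Context {K : fieldType} {d : Order.disp_t} {P : porderType d}.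

Lemma pmor_scale_natural (M N : pmodule K P) (k : K) (f : pmorphism M N) p q
    (pq : (p <= q)%O) x :
  (k \*: f q) (pm_map M pq x) = pm_map N pq ((k \*: f p) x).
Proof. by rewrite /= pmor_natural linearZ. Qed.
Definition pmor_scale (M N : pmodule K P) (k : K) (f : pmorphism M N) :
    pmorphism M N :=
  @PMorphism K d P M N (fun p => k \*: f p) (pmor_scale_natural k f).

Lemma pmor_zero_natural (M N : pmodule K P) p q (pq : (p <= q)%O) x :
  (\0 : {linear M q -> N q}) (pm_map M pq x) =
  pm_map N pq ((\0 : {linear M p -> N p}) x).
Proof. by rewrite /= linear0. Qed.
Definition pmor_zero (M N : pmodule K P) : pmorphism M N :=
  @PMorphism K d P M N (fun p => \0) (@pmor_zero_natural M N).

End Modules.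

Section Interleavings.
Context {R : realType} {K : fieldType} {d : Order.disp_t} {P : porderType d}.
Variable Om : flow P R.
Implicit Types (M N : pmodule K P) (e : {nonneg R}).

(** Composition in the category whose morphisms of degree [t] from [L] to [M]
are the morphisms from [L] to the shift of [M] by [t]. *)
Definition pmor_comp_shift L M N (s t : R) (g : pmorphism M (pm_shift Om N s))
    (f : pmorphism L (pm_shift Om M t)) : pmorphism L (pm_shift Om N (s + t)) :=
  pmor_comp (shiftD Om N s t) (pmor_comp (pm_shift_mor Om g t) f).

(** One of the two symmetric conditions on an interleaving. Isolating it lets
an argument be made for one side and then applied twice; in particular the
bars of [M] are matched using only that the transition of [M] by twice [e]
factors through a shift of [N]. *)
Definition is_half_interleaving e M N (f : pmorphism M (pm_shift Om N e%:num))
    (g : pmorphism N (pm_shift Om M e%:num)) : Prop :=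
  pmor_eq (pmor_comp_shift g f) (pm_transition Om M (e%:num + e%:num)%:nng).

Lemma half_interleaving_iso e M N M' N' (f : pmorphism M (pm_shift Om N e%:num))
    (g : pmorphism N (pm_shift Om M e%:num))
    (u : pmorphism M M') (u' : pmorphism M' M)
    (v : pmorphism N N') (v' : pmorphism N' N) :
  (forall p, cancel (u' p) (u p)) -> (forall p, cancel (v p) (v' p)) ->
  is_half_interleaving f g ->
  is_half_interleaving
    (pmor_comp (pm_shift_mor Om v e%:num) (pmor_comp f u'))
    (pmor_comp (pm_shift_mor Om u e%:num) (pmor_comp g v')).
Proof.
move=> u'K vK fg p x /=.
by rewrite vK -pmor_natural [X in u _ X](fg p (u' p x)) /= pmor_natural u'K.
Qed.

Lemma pm_interleaved_sym e M N :
  pm_interleaved Om e M N -> pm_interleaved Om e N M.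
Proof. by move=> [f [g [gf fg]]]; exists g, f. Qed.

Section Lengthen.
Variables (e e' : {nonneg R}) (ee' : e%:num <= e'%:num).

Lemma pmor_lengthen_natural M N (f : pmorphism M (pm_shift Om N e%:num)) p q
    (pq : (p <= q)%O) x :
  (pm_map N (flow_le Om q ee') \o f q) (pm_map M pq x) =
  pm_map (pm_shift Om N e'%:num) pq ((pm_map N (flow_le Om p ee') \o f p) x).
Proof.
rewrite /= pmor_natural /=.
have pq' := le_trans (flow_le Om p ee') (flow_homo Om e'%:num pq).
by rewrite !(pm_map_comp _ _ pq').
Qed.
Definition pmor_lengthen M N (f : pmorphism M (pm_shift Om N e%:num)) :
    pmorphism M (pm_shift Om N e'%:num) :=
  @PMorphism K d P M (pm_shift Om N e'%:num)
    (fun p => pm_map N (flow_le Om p ee') \o f p) (pmor_lengthen_natural f).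

(** By naturality, all the added transitions can be moved past [f] and [g] to
the end, where they merge into a single structure map of [M]. *)
Lemma half_interleaving_lengthen M N (f : pmorphism M (pm_shift Om N e%:num))
    (g : pmorphism N (pm_shift Om M e%:num)) :
  is_half_interleaving f g ->
  is_half_interleaving (pmor_lengthen f) (pmor_lengthen g).
Proof.
move=> gf p x; have /= := gf p x; rewrite /= pmor_natural /= => gfpx.
have le1 : (Om e%:num (Om e%:num p) <= Om (e'%:num + e'%:num) p)%O.
  rewrite -flowD; apply: flow_le; exact: lerD.
have le2 : (Om (e%:num + e%:num) p <= Om (e'%:num + e'%:num) p)%O.
  by apply: flow_le; exact: lerD.
have le3 := le_trans (flow_homo Om e%:num (flow_le Om p ee'))
  (flow_le Om (Om e'%:num p) ee').
rewrite (pm_map_comp _ _ le3) (pm_map_comp _ _ le1).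
rewrite -(pm_map_comp (flowD_le Om e%:num e%:num p) le2) gfpx.
exact: pm_map_comp.
Qed.

Lemma pm_interleaved_le M N :
  pm_interleaved Om e M N -> pm_interleaved Om e' M N.
Proof.
move=> [f [g [gf fg]]]; exists (pmor_lengthen f), (pmor_lengthen g).
by split; exact: half_interleaving_lengthen.
Qed.

End Lengthen.
End Interleavings.

(** * Direct sums *)

Section DirectSum.
Context {K : fieldType} {A : Type} (V : A -> lmodType K).

Definition dsum_proj a (x : dsum V) : V a := x a.

Lemma dsum_proj_linear a : linear (dsum_proj a).
Proof. by []. Qed.
HB.instance Definition _ a := GRing.isLinear.Build K (dsum V) (V a) *:%R
  (dsum_proj a) (dsum_proj_linear a).

Definition dsum_single a (x : V a) (b : A) : V b :=
  if pselect (a = b) is left ab then eq_rect a V x b ab else 0.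

Lemma dsum_single_id a (x : V a) : dsum_single x a = x.
Proof.
rewrite /dsum_single; case: pselect => // aa.
by rewrite (Prop_irrelevance aa erefl).
Qed.

Lemma dsum_single_neq a (x : V a) b : a <> b -> dsum_single x b = 0.
Proof. by rewrite /dsum_single; case: pselect. Qed.

Lemma dsum_single_finite a (x : V a) :
  finite_set [set b | dsum_single x b != 0].
Proof.
apply: sub_finite_set (finite_set1 a) => b /= /eqP nz.
by apply: contrapT => ba; apply: nz; apply: dsum_single_neq => /esym.
Qed.
Definition dsum_inj a (x : V a) : dsum V := DSum (dsum_single_finite x).

Lemma dsum_inj_linear a : linear (@dsum_inj a).
Proof.
move=> k x y; apply: dsum_ext => b /=.
have [ab|ab] := pselect (a = b); first by subst b; rewrite !dsum_single_id.
by rewrite !dsum_single_neq // scaler0 addr0.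
Qed.
HB.instance Definition _ a := GRing.isLinear.Build K (V a) (dsum V) *:%R
  (@dsum_inj a) (@dsum_inj_linear a).

(** Bundled for an abstract family [V]: unification does not find the linear
structure at a family given as a lambda abstraction, such as the one formed by
the spaces of the modules at a point. *)
Definition dsum_inj_lin a : {linear V a -> dsum V} := @dsum_inj a.
Definition dsum_proj_lin a : {linear dsum V -> V a} := dsum_proj a.

(** An element of a direct sum is the finite sum of its components, so a
linear map that kills every component of [y] kills [y]. This selects, without
writing any infinite matrix, a nonzero term in a sum over the bars. *)
Lemma dsum_linear_neq0 (W : lmodType K) (G : {linear dsum V -> W})
    (y : dsum V) :
  G y != 0 -> exists a, G (dsum_inj (y a)) != 0.
Proof.
apply: contra_neqP => /forallNP G0.
have {}G0 a : G (dsum_inj (y a)) = 0 by apply/eqP/negPn/negP; exact: G0.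
have /(@finite_seqP {classic A}) [s sE] := dsum_finite y.
(* Induct on a list containing the support; the statement is generalized to
   the truncations [z] of [y], obtained by deleting components. *)
suff H : forall z : dsum V, (forall a, z a = y a \/ z a = 0) ->
    (forall a : {classic A}, z a != 0 -> a \in s) -> G z = 0.
  apply: H => [a|a nz]; first by left.
  by have : [set` s] a by rewrite -sE.
elim: s {sE} => [|b s IHs] z zy zs.
  rewrite (_ : z = 0) ?linear0 //; apply: dsum_ext => a.
  by apply/eqP/negPn/negP => /zs.
have -> : z = dsum_inj (z b) + (z - dsum_inj (z b)) by rewrite addrC subrK.
rewrite linearD [X in X + _](_ : _ = 0) ?add0r; last first.
  by have [->|->] := zy b; rewrite ?linear0.
apply: IHs => a /=; have [ba|ba] := pselect (b = a).
- by subst b; right; rewrite dsum_single_id subrr.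
- by rewrite dsum_single_neq // subr0.
- by subst b; rewrite dsum_single_id subrr eqxx.
- rewrite dsum_single_neq // subr0 => /zs; rewrite in_cons => /orP[/eqP ab|//].
  by case: ba.
Qed.

End DirectSum.

Section DirectSumModule.
Context {K : fieldType} {d : Order.disp_t} {P : porderType d}.
Context {A : Type} (M : A -> pmodule K P).

Lemma dsum_pmodule_inj_natural a p q (pq : (p <= q)%O) x :
  dsum_inj (V := M ^~ q) (pm_map (M a) pq x) =
  pm_map (dsum_pmodule M) pq (dsum_inj (V := M ^~ p) x).
Proof.
apply: dsum_ext => b /=.
have [ab|ab] := pselect (a = b); first by subst b; rewrite !dsum_single_id.
by rewrite !dsum_single_neq // linear0.
Qed.
Definition dsum_pmodule_inj a : pmorphism (M a) (dsum_pmodule M) :=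
  @PMorphism K d P (M a) (dsum_pmodule M) (fun p => dsum_inj_lin (M ^~ p) a)
    (@dsum_pmodule_inj_natural a).

Definition dsum_pmodule_proj a : pmorphism (dsum_pmodule M) (M a) :=
  @PMorphism K d P (dsum_pmodule M) (M a) (fun p => dsum_proj_lin (M ^~ p) a)
    (fun p q pq x => erefl).

End DirectSumModule.

(** * Morphisms between interval modules *)

Section IntervalCoordinates.
Context {K : fieldType}.
Implicit Types b c : bool.

(** The space [interval_space b] depends on the boolean [b], which cannot be
rewritten inside a morphism. Elements are therefore compared through a
coordinate in [K], and everything is generated by [interval_gen b]; both are
zero when the space is. *)
Definition interval_coord b : {linear @interval_space K b -> K^o} :=
  interval_map b true.
Arguments interval_coord {b}.
Definition interval_gen b : @interval_space K b :=
  interval_map true b (1 : K^o).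

Lemma interval_coord_inj b : injective (@interval_coord b).
Proof. by case: b => // x y _; apply/rowP; case. Qed.

Lemma interval_coord_gen b : interval_coord (interval_gen b) = b%:R.
Proof. by case: b. Qed.

Lemma interval_gen0 b : ~~ b -> interval_gen b = 0.
Proof. by case: b. Qed.

Lemma interval_coord0 b (x : @interval_space K b) :
  ~~ b -> interval_coord x = 0.
Proof. by case: b x. Qed.

Lemma interval_coord_map b c x :
  interval_coord (interval_map b c x) = c%:R * interval_coord x.
Proof.
by case: b c x => [] [] x; rewrite /interval_coord /= ?mul1r ?mul0r ?mulr0.
Qed.

Lemma interval_genE b (x : @interval_space K b) :
  x = interval_coord x *: interval_gen b.
Proof.
apply: interval_coord_inj; rewrite linearZ interval_coord_gen.
case: b x => x /=; rewrite /interval_coord /= ?scaler0 //.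
by rewrite /GRing.scale /= mulr1.
Qed.

Lemma interval_coord_linear b c
    (h : {linear @interval_space K b -> @interval_space K c}) x :
  interval_coord (h x) = interval_coord x * interval_coord (h (interval_gen b)).
Proof. by rewrite {1}(interval_genE x) 2!linearZ. Qed.

End IntervalCoordinates.
Arguments interval_coord {K b}.

Local Identity Coercion set_Funclass : set >-> Funclass.

Section IntervalMorphisms.
Context {R : realType} {K : fieldType} {d : Order.disp_t} {P : porderType d}.
Variable Om : flow P R.
Implicit Types I J L : poset_interval P.
Local Notation C I := (interval_pmodule K I).

(** The 1 x 1 matrix of [h] at [p], with value zero at the points where its
source or its target vanishes. *)
Definition pmor_coef I J (t : R) (h : pmorphism (C I) (pm_shift Om (C J) t))
    p : K :=
  interval_coord (h p (interval_gen (p \in (I : set P)))).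

Section Coef.
Variables (I J : poset_interval P) (t : R).
Implicit Types h : pmorphism (C I) (pm_shift Om (C J) t).

Lemma pmor_coefE h p x :
  interval_coord (h p x) = interval_coord x * pmor_coef h p.
Proof. exact: interval_coord_linear. Qed.

Lemma pmor_coef_neq0 h p : pmor_coef h p != 0 -> I p /\ J (Om t p).
Proof.
rewrite /pmor_coef => nz; split; apply: contra_neqP nz => out.
  by rewrite interval_gen0 ?(memNset out) // !linear0.
by rewrite interval_coord0 // (memNset out).
Qed.

Lemma pmor_coef_scale k h p :
  pmor_coef (pmor_scale k h) p = k * pmor_coef h p.
Proof. by rewrite /pmor_coef /= linearZ. Qed.

Lemma pmor_coef_natural h p q : (p <= q)%O -> I p -> I q -> J (Om t q) ->
  pmor_coef h p = pmor_coef h q.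
Proof.
move=> pq Ip Iq Jq.
have /(congr1 (@interval_coord K _)) := pmor_natural h pq (interval_gen _).
rewrite [in X in X -> _]/= pmor_coefE !interval_coord_map interval_coord_gen.
rewrite -/(pmor_coef h p) (mem_set Ip) (mem_set Iq) (mem_set Jq).
by rewrite !mul1r => ->.
Qed.

(** The Hom space between [C(I)] and a shift of [C(J)] has dimension at most
one when the common support is connected: the coefficient is constant there
and vanishes elsewhere. *)
Lemma pmor_coef_unique h h' p :
  poset_connected ((I : set P) `&` Om t @^-1` J) ->
  pmor_coef h p != 0 -> pmor_coef h p = pmor_coef h' p -> pmor_eq h h'.
Proof.
move=> conn nz hh' q x; apply: interval_coord_inj; rewrite !pmor_coefE.
congr (_ * _).
have const (g : pmorphism (C I) (pm_shift Om (C J) t)) r r' :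
    ((I : set P) `&` Om t @^-1` J) r ->
    ((I : set P) `&` Om t @^-1` J) r' -> pmor_coef g r = pmor_coef g r'.
  apply: (poset_connected_const conn) => {}r {}r' [Ir _] [Ir' Jr'] rr'.
  exact: pmor_coef_natural.
have Sp := pmor_coef_neq0 nz.
have [Sq|Sq] := pselect (((I : set P) `&` Om t @^-1` J) q).
  by rewrite (const h q p) // (const h' q p).
by transitivity (0 : K); [|symmetry];
  apply: contra_notP Sq => /eqP /pmor_coef_neq0.
Qed.

End Coef.

Lemma pmor_coef_comp I J L (s t : R) (g : pmorphism (C J) (pm_shift Om (C L) s))
    (f : pmorphism (C I) (pm_shift Om (C J) t)) p :
  pmor_coef (pmor_comp_shift g f) p = pmor_coef f p * pmor_coef g (Om t p).
Proof.
rewrite {1}/pmor_coef /= interval_coord_map pmor_coefE -/(pmor_coef f p).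
have [Lp|/negP nLp] := boolP (Om (s + t) p \in (L : set P)); first exact: mul1r.
(* Outside [L] the identification of the double shift vanishes, and so does
   the coefficient of [g]. *)
rewrite mul0r; apply/esym/eqP; rewrite mulf_eq0; apply/orP; right.
by apply: contra_notT nLp => /pmor_coef_neq0[_]; rewrite -flowD => /mem_set.
Qed.

Lemma pmor_coef_transition I (e : {nonneg R}) p :
  I p -> I (Om e%:num p) -> pmor_coef (pm_transition Om (C I) e) p = 1.
Proof.
move=> Ip Iep; rewrite /pmor_coef /= interval_coord_map interval_coord_gen.
by rewrite !mem_set // mul1r.
Qed.

Lemma interval_interleaved_zero I (e : {nonneg R}) :
  (forall p, I p -> ~ I (Om (e%:num + e%:num) p)) ->
  pm_interleaved Om e (C I) zero_pmodule.
Proof.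
move=> short; exists (pmor_zero _ _), (pmor_zero _ _); split=> p x; last first.
  by apply/rowP; case.
apply: interval_coord_inj; rewrite !pmor_coefE; congr (_ * _).
rewrite {1}/pmor_coef /= 2!linear0; symmetry; apply/eqP/negPn/negP.
by move=> /pmor_coef_neq0[/short].
Qed.

(** The composite of [f] and [g] on [C(I)] is a nonzero multiple of the
transition, so after rescaling [g] it is the transition. The other composite
is a multiple of the transition of [C(J)]; its factor is read off at the point
[Om e p], and for this the point must satisfy both [J (Om e p)] and
[J (Om (3e) p)]. The latter holds because the rescaled composite is nonzero at
[Om (2e) p] as well, and this is where [I (Om (4e) p)] is used. *)
Lemma interval_interleaved_of_comp_neq0 I J (e : {nonneg R})
    (f : pmorphism (C I) (pm_shift Om (C J) e%:num))
    (g : pmorphism (C J) (pm_shift Om (C I) e%:num)) p :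
  poset_connected ((I : set P) `&` Om (e%:num + e%:num) @^-1` I) ->
  poset_connected ((J : set P) `&` Om (e%:num + e%:num) @^-1` J) ->
  pmor_coef (pmor_comp_shift g f) p != 0 ->
  I (Om (e%:num + e%:num) (Om (e%:num + e%:num) p)) ->
  pm_interleaved Om e (C I) (C J).
Proof.
move=> connI connJ gf_neq0 I4p.
have [Ip I2p] := pmor_coef_neq0 gf_neq0.
set c := pmor_coef (pmor_comp_shift g f) p in gf_neq0.
pose g' := pmor_scale c^-1 g.
have g'fp : pmor_coef (pmor_comp_shift g' f) p = 1.
  rewrite pmor_coef_comp pmor_coef_scale mulrCA -pmor_coef_comp.
  exact: mulVf.
have g'f : is_half_interleaving f g'.
  apply: (@pmor_coef_unique I I _ _ _ p) => //; rewrite g'fp ?oner_neq0 //.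
  exact/esym/(@pmor_coef_transition I (e%:num + e%:num)%:nng).
exists f, g'; split=> //.
have : pmor_coef (pmor_comp_shift g' f) (Om (e%:num + e%:num) p) != 0.
  suff -> : pmor_coef (pmor_comp_shift g' f) (Om (e%:num + e%:num) p) = 1.
    exact: oner_neq0.
  rewrite /pmor_coef g'f.
  exact: (@pmor_coef_transition I (e%:num + e%:num)%:nng).
rewrite pmor_coef_comp mulf_eq0 negb_or => /andP[/pmor_coef_neq0[_ J3p] _].
(* Both composites are products of a coefficient of [f] and the coefficient
   of [g] at [Om e p]; those of [f] are taken at [p] and at [Om (2e) p]. *)
have fp : pmor_coef f p = pmor_coef f (Om (e%:num + e%:num) p).
  apply: pmor_coef_natural => //.
  exact: (flow_ge Om (e%:num + e%:num)%:nng).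
have fg'p : pmor_coef (pmor_comp_shift f g') (Om e%:num p) = 1.
  by rewrite pmor_coef_comp -flowD -fp mulrC -pmor_coef_comp.
have [Jp J3p'] : J (Om e%:num p) /\ J (Om (e%:num + e%:num) (Om e%:num p)).
  apply: (@pmor_coef_neq0 _ _ _ (pmor_comp_shift f g')).
  by rewrite fg'p oner_neq0.
apply: (@pmor_coef_unique J J _ _ _ (Om e%:num p)) => //;
  rewrite fg'p ?oner_neq0 //.
exact/esym/(@pmor_coef_transition J (e%:num + e%:num)%:nng).
Qed.

(** * Matching summands *)

Section Matching.
Context {A A' : Type} (B : A -> poset_interval P) (B' : A' -> poset_interval P).
Variable e : {nonneg R}.
Local Notation DB := (dsum_pmodule (fun a => C (B a))).
Local Notation DB' := (dsum_pmodule (fun a => C (B' a))).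

Definition pmor_component (S S' : Type) (X : S -> pmodule K P)
    (Y : S' -> pmodule K P) (t : R)
    (h : pmorphism (dsum_pmodule X) (pm_shift Om (dsum_pmodule Y) t)) a a' :
    pmorphism (X a) (pm_shift Om (Y a') t) :=
  pmor_comp (pm_shift_mor Om (dsum_pmodule_proj Y a') t)
    (pmor_comp h (dsum_pmodule_inj X a)).

Hypothesis B_conn : forall a t,
  poset_connected ((B a : set P) `&` Om t @^-1` B a).
Hypothesis B'_conn : forall a t,
  poset_connected ((B' a : set P) `&` Om t @^-1` B' a).

(** At [p], the composite of [f] and [g] restricted to the summand [B a] is the
transition, whose value on the generator is nonzero. It is the sum, over the
bars [B' a'], of the composites through [B' a'], so one of these is nonzero. *)
Lemma half_interleaving_match (f : pmorphism DB (pm_shift Om DB' e%:num))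
    (g : pmorphism DB' (pm_shift Om DB e%:num)) a p :
  is_half_interleaving f g -> B a p ->
  B a (Om (e%:num + e%:num) (Om (e%:num + e%:num) p)) ->
  exists a', pm_interleaved Om e (C (B a)) (C (B' a')).
Proof.
move=> gf Bp B4p.
have B2p : B a (Om (e%:num + e%:num) p).
  have [cvx _] := poset_interval_prop (B a).
  by apply: cvx Bp B4p _ _; exact: (flow_ge Om (e%:num + e%:num)%:nng).
pose x := interval_gen (p \in (B a : set P)) : C (B a) p.
pose y : DB' (Om e%:num p) := f p (dsum_pmodule_inj _ a p x).
pose G : {linear DB' (Om e%:num p) -> C (B a) (Om (e%:num + e%:num) p)} :=
  pm_map (C (B a)) (flowD_le Om e%:num e%:num p) \o
  (dsum_pmodule_proj _ a _ \o g (Om e%:num p)).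
have : G y != 0.
  have -> : G y = pm_transition Om (C (B a)) (e%:num + e%:num)%:nng p x.
    have /(congr1 (dsum_proj a)) := gf p (dsum_pmodule_inj _ a p x).
    by rewrite /= /dsum_proj /= dsum_single_id.
  rewrite -(inj_eq (@interval_coord_inj _ _)) linear0.
  rewrite [X in X != _](_ : _ = 1) ?oner_neq0 //.
  exact: (@pmor_coef_transition (B a) (e%:num + e%:num)%:nng).
case/dsum_linear_neq0 => a' nz; exists a'.
apply: (@interval_interleaved_of_comp_neq0 _ _ _
  (pmor_component f a a') (pmor_component g a' a) p) => //.
apply: contra_neq nz => coef0.
by apply: interval_coord_inj; rewrite linear0; exact: coef0.
Qed.

End Matching.
End IntervalMorphisms.

Theorem theorem6p2 (R : realType) (K : fieldType) (d : Order.disp_t)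
    (P : porderType d) (Om : flow P R) (F : set (set P))
    (F_interval : forall I : set P, F I -> is_poset_interval I)
    (F_set0 : F set0)
    (F_setI : forall I J : set P, F I -> F J -> F (I `&` J))
    (F_flow : forall (I : set P) (t : R), F I -> F (Om t @` I))
    (M N : pmodule K P) (A A' : Type)
    (BM : A -> poset_interval P) (BN : A' -> poset_interval P)
    (M_BM : is_barcode M BM) (N_BN : is_barcode N BN)
    (BM_F : forall a : A, F (BM a)) (BN_F : forall a' : A', F (BN a')) :
  (hausdorff_dist K Om BM BN <= 2%:E * interleaving_dist Om M N)%E.
Proof.
have F_conn (I : set P) t : F I -> poset_connected (I `&` Om t @^-1` I).
  move=> FI; rewrite flow_preimage.
  by have [_] := F_interval _ (F_setI _ _ FI (F_flow _ (- t) FI)).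
rewrite -lee_pdivrMl //; apply: le_ereal_inf_tmp => _ [e [f [g [gf fg]]] <-].
rewrite lee_pdivrMl // -EFinM mulrDl mul1r.
have ee2 : e%:num <= (e%:num + e%:num)%:nng%:num by rewrite /= lerDl.
apply: ereal_inf_lbound; exists (e%:num + e%:num)%:nng => //=.
have [_ [u [u' [uK u'K]]]] := M_BM; have [_ [v [v' [vK v'K]]]] := N_BN.
have gf' := half_interleaving_iso u'K vK gf.
have fg' := half_interleaving_iso v'K uK fg.
exists (fun a a' => pm_interleaved Om e (interval_pmodule K (BM a))
  (interval_pmodule K (BN a'))); split=> [a a' /(pm_interleaved_le ee2)//|a|a'].
- move=> nomatch; apply: interval_interleaved_zero => p Bp /=.
  rewrite flowD => B4p; apply: nomatch.
  by apply: (half_interleaving_match _ _ gf' Bp B4p) => *; exact: F_conn.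
- move=> nomatch; apply: interval_interleaved_zero => p Bp /=.
  rewrite flowD => B4p; apply: nomatch.
  have [||a /pm_interleaved_sym] := half_interleaving_match _ _ fg' Bp B4p.
  + by move=> *; exact: F_conn.
  + by move=> *; exact: F_conn.
  by exists a.
Qed.
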